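(* Let $A$ be a Hom-coPoisson bialgebra (resp. Hom-coPoisson Hopf algebra) over a field $\mathbb K$ of characteristic $0$, with cobracket $\delta$ and twisting map $\alpha$. If $A$ is an almost normalizing extension over $\mathbb K$, then the bialgebra (resp. Hopf) dual $A^\circ$ is a Hom-Poisson bialgebra (resp. Hom-Poisson Hopf algebra) with twisting map $\alpha^\circ$ and bracket $$\{f,g\}(x)=\langle\delta(x),f\otimes g\rangle,\qquad x\in A,$$ for any $f,g\in A^\circ$, where $\langle\cdot,\cdot\rangle$ is the natural pairing between the vector space $A\otimes A$ and its dual vector space.
   Context: All maps are linear over $\mathbb K$. Let $\sigma(x_1\otimes x_2\otimes x_3)=x_3\otimes x_1\otimes x_2$, and let $\tau_{ij}$ exchange the tensor factors $i$ and $j$. Throughout, Hom-algebras and Hom-coalgebras are multiplicative: a product or bracket $\mu$ satisfies $\alpha\circ\mu=\mu\circ\alpha^{\otimes2}$, and a coproduct or cobracket $\Delta$ satisfies $\alpha^{\otimes2}\circ\Delta=\Delta\circ\alpha$. Hom-associative algebra $(A,\mu,\alpha)$: $\mu\circ(\mu\otimes\alpha)=\mu\circ(\alpha\otimes\mu)$; unital if there is $1=\eta(1)\in A$ with $1x=x1=\alpha(x)$ for all $x$. Hom-Lie algebra $(A,\{\cdot,\cdot\},\alpha)$: skew-symmetric bracket with $\{\alpha(x),\{y,z\}\}+\{\alpha(y),\{z,x\}\}+\{\alpha(z),\{x,y\}\}=0$. Hom-coassociative coalgebra $(A,\Delta,\alpha)$: $(\alpha\otimes\Delta)\circ\Delta=(\Delta\otimes\alpha)\circ\Delta$;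 counital if there is $\varepsilon:A\to\mathbb K$ with $(\mathrm{id}\otimes\varepsilon)\circ\Delta=\alpha=(\varepsilon\otimes\mathrm{id})\circ\Delta$. Hom-bialgebra $(A,\mu,\eta,\Delta,\varepsilon,\alpha)$: unital Hom-associative and counital Hom-coassociative with the same $\alpha$, with $\Delta(1)=1\otimes1$, $\Delta(xy)=\sum x_1y_1\otimes x_2y_2$, $\varepsilon(1)=1$, $\varepsilon(xy)=\varepsilon(x)\varepsilon(y)$, $\varepsilon\circ\alpha=\varepsilon$. Hom-Hopf algebra: a Hom-bialgebra with an antipode, i.e. a linear $S:A\to A$ inverse to $\mathrm{Id}_A$ for the convolution product $f\star g=\mu\circ(f\otimes g)\circ\Delta$ with unit $\eta\circ\varepsilon$ ($S\star\mathrm{Id}=\mathrm{Id}\star S=\eta\circ\varepsilon$). Hom-coPoisson algebra $(A,\Delta,\varepsilon,\alpha,\delta)$: a cocommutative ($\tau_{12}\circ\Delta=\Delta$) counital Hom-coassociative coalgebra with a linear map $\delta:A\to A\otimes A$ (the cobracket) satisfying $\tau_{12}\circ\delta=-\delta$, $(\mathrm{Id}+\sigma+\sigma^2)\circ(\alpha\otimes\delta)\circ\delta=0$ and $(\Delta\otimes\alpha)\circ\delta=(\alpha\otimes\delta)\circ\Delta+\tau_{23}\circ(\delta\otimes\alpha)\circ\Delta$. Hom-coPoisson bialgebra (resp. Hopf algebra): a Hom-coPoisson algebra that is also a Hom-bialgebra (resp. Hom-Hopf algebra) for the same $\Delta,\varepsilon,\alpha$, with $\delta\circ\mu=(\mu\otimes\mu)\circ\tau_{23}\circ(\delta\otimes\Delta+\Delta\otimes\delta)$.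 Hom-Poisson algebra $(A,\mu,\{\cdot,\cdot\},\alpha)$: $(A,\mu,\alpha)$ is a commutative Hom-associative algebra, $(A,\{\cdot,\cdot\},\alpha)$ is a Hom-Lie algebra, and $\{xy,\alpha(z)\}=\alpha(x)\{y,z\}+\{x,z\}\alpha(y)$. Hom-Poisson bialgebra (resp. Hopf algebra): a Hom-Poisson algebra that is also a Hom-bialgebra (resp. Hom-Hopf algebra) for the same $\mu,\alpha$, with $\Delta(\{a,b\})=\{\Delta(a),\Delta(b)\}$, where $\{a_1\otimes a_2,b_1\otimes b_2\}:=\{a_1,b_1\}\otimes a_2b_2+a_1b_1\otimes\{a_2,b_2\}$. Almost normalizing extension over $\mathbb K$: $A$ is a finitely generated $\mathbb K$-algebra with generators $x_1,\dots,x_n$ satisfying $x_ix_j-x_jx_i\in\sum_{l=1}^n\mathbb Kx_l+\mathbb K$ for all $i,j$ (where $\mathbb K$ denotes the multiples of the unit). Dual: $A^\circ=\{f\in A^*: f(I)=0\text{ for some cofinite ideal }I\text{ of }A\}$, where an ideal $I$ is cofinite if $A/I$ is finite dimensional. For a map $f:A\to B$, $f^\circ$ is the restriction of $f^*$ to $B^\circ$, with values in $A^\circ$. On $A^\circ$ the product is $(fg)(x)=(f\otimes g)(\Delta(x))$, the unit is $\varepsilon$, the coproduct is $\mu^\circ$ (i.e. $\Delta(f)(x\otimes y)=f(xy)$, in $A^\circ\otimes A^\circ=(A\otimes A)^\circ$), the counit is $f\mapsto f(1)$, the twisting map is $\alpha^\circ$, and in the Hopf case the antipode is $S^\circ$.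
   Formalization: In the Hopf case it is assumed that the transpose of the antipode S maps A° into A°, so that S° is defined; this can fail for Hom-Hopf algebras whose twisting map is not injective. *)

(* Defs.v *)
From HB Require Import structures.
From mathcomp Require Import all_boot all_algebra.
From mathcomp Require Import boolp functions.

Set Implicit Arguments.
Unset Strict Implicit.
Unset Printing Implicit Defensive.

Import GRing.Theory.
Local Open Scope ring_scope.
Local Open Scope quotient_scope.

(* The tensor product of two K-vector spaces: formal sums of pairs, two of    *)
(* them being identified when every bilinear map, into any K-vector space,    *)
(* takes the same value on both.                                              *)
Section TensorProduct.
Variables (K : fieldType) (U V : lmodType K).

Local Notation formal_tensor := (seq (U * V)).

Definition bil_sum (W : lmodType K) (b : U -> V -> W) (s : formal_tensor) : W :=
  \sum_(p <- s) b p.1 p.2.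

Definition tensor_equiv : rel formal_tensor := fun s t =>
  `[< forall (W : lmodType K) (b : {bilinear U -> V -> W}),
        bil_sum b s = bil_sum b t >].

Lemma tensor_equivP s t :
  reflect (forall (W : lmodType K) (b : {bilinear U -> V -> W}),
             bil_sum b s = bil_sum b t) (tensor_equiv s t).
Proof. exact: asboolP. Qed.

Lemma tensor_equiv_refl : reflexive tensor_equiv.
Proof. by move=> s; apply/tensor_equivP. Qed.

Lemma tensor_equiv_sym : symmetric tensor_equiv.
Proof. by move=> s t; apply/tensor_equivP/tensor_equivP => h W b; rewrite h. Qed.

Lemma tensor_equiv_trans : transitive tensor_equiv.
Proof.
move=> t s u /tensor_equivP st /tensor_equivP tu; apply/tensor_equivP => W b.
by rewrite st.
Qed.

Canonical tensor_equiv_equiv :=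
  EquivRel tensor_equiv tensor_equiv_refl tensor_equiv_sym tensor_equiv_trans.

Definition tensor : Type := {eq_quot tensor_equiv}.
HB.instance Definition _ := EqQuotient.on tensor.
HB.instance Definition _ := Choice.on tensor.

Lemma tensor_eqP (s t : formal_tensor) :
  reflect (forall (W : lmodType K) (b : {bilinear U -> V -> W}),
             bil_sum b s = bil_sum b t) (\pi_tensor s == \pi_tensor t).
Proof.
apply: (iffP eqP) => [/eqP|h]; first by rewrite eqmodE => /tensor_equivP.
by apply/eqP; rewrite eqmodE; apply/tensor_equivP.
Qed.

Definition formal_scale (a : K) (s : formal_tensor) : formal_tensor :=
  [seq (a *: p.1, p.2) | p <- s].

Lemma bil_sum_cat (W : lmodType K) (b : U -> V -> W) s t :
  bil_sum b (s ++ t) = bil_sum b s + bil_sum b t.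
Proof. exact: big_cat. Qed.

Lemma bil_sum_scale (W : lmodType K) (b : {bilinear U -> V -> W}) a s :
  bil_sum b (formal_scale a s) = a *: bil_sum b s.
Proof.
rewrite /bil_sum big_map scaler_sumr; apply: eq_bigr => p _ /=.
by rewrite linearZl_LR.
Qed.

Lemma bil_sum_repr (W : lmodType K) (b : {bilinear U -> V -> W}) s :
  bil_sum b (repr (\pi_tensor s)) = bil_sum b s.
Proof. by apply/tensor_eqP: W b; rewrite reprK. Qed.

Definition tensor_zero : tensor := \pi_tensor [::].
Definition tensor_add (x y : tensor) : tensor := \pi_tensor (repr x ++ repr y).
Definition tensor_scale (a : K) (x : tensor) : tensor :=
  \pi_tensor (formal_scale a (repr x)).
Definition tensor_opp (x : tensor) : tensor := tensor_scale (-1) x.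

Definition tensor_lift_fun (W : lmodType K) (b : U -> V -> W) (x : tensor) : W :=
  bil_sum b (repr x).

Lemma tensor_ext (x y : tensor) :
  (forall (W : lmodType K) (b : {bilinear U -> V -> W}),
     tensor_lift_fun b x = tensor_lift_fun b y) -> x = y.
Proof. by move=> h; rewrite -[x]reprK -[y]reprK; apply/eqP/tensor_eqP. Qed.

Lemma lift_fun0 (W : lmodType K) (b : {bilinear U -> V -> W}) :
  tensor_lift_fun b tensor_zero = 0.
Proof. by rewrite /tensor_lift_fun bil_sum_repr /bil_sum big_nil. Qed.

Lemma lift_funD (W : lmodType K) (b : {bilinear U -> V -> W}) x y :
  tensor_lift_fun b (tensor_add x y) =
  tensor_lift_fun b x + tensor_lift_fun b y.
Proof. by rewrite /tensor_lift_fun bil_sum_repr bil_sum_cat. Qed.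

Lemma lift_funZ (W : lmodType K) (b : {bilinear U -> V -> W}) a x :
  tensor_lift_fun b (tensor_scale a x) = a *: tensor_lift_fun b x.
Proof. by rewrite /tensor_lift_fun bil_sum_repr bil_sum_scale. Qed.

Lemma tensor_addA : associative tensor_add.
Proof. by move=> x y z; apply: tensor_ext => W b; rewrite !lift_funD addrA. Qed.

Lemma tensor_addC : commutative tensor_add.
Proof. by move=> x y; apply: tensor_ext => W b; rewrite !lift_funD addrC. Qed.

Lemma tensor_add0 : left_id tensor_zero tensor_add.
Proof.
by move=> x; apply: tensor_ext => W b; rewrite lift_funD lift_fun0 add0r.
Qed.

Lemma tensor_addN : left_inverse tensor_zero tensor_opp tensor_add.
Proof.
move=> x; apply: tensor_ext => W b.
by rewrite lift_funD lift_fun0 lift_funZ scaleN1r addNr.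
Qed.

HB.instance Definition _ := GRing.isZmodule.Build tensor
  tensor_addA tensor_addC tensor_add0 tensor_addN.

Lemma tensor_scaleA a b (x : tensor) :
  tensor_scale a (tensor_scale b x) = tensor_scale (a * b) x.
Proof. by apply: tensor_ext => W c; rewrite !lift_funZ scalerA. Qed.

Lemma tensor_scale1 : left_id 1 tensor_scale.
Proof. by move=> x; apply: tensor_ext => W c; rewrite lift_funZ scale1r. Qed.

Lemma tensor_scaleDr : right_distributive tensor_scale +%R.
Proof.
move=> a x y; apply: tensor_ext => W c.
by rewrite lift_funD !lift_funZ lift_funD scalerDr.
Qed.

Lemma tensor_scaleDl x : {morph tensor_scale^~ x : a b / a + b}.
Proof.
move=> a b; apply: tensor_ext => W c.
by rewrite lift_funD !lift_funZ scalerDl.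
Qed.

HB.instance Definition _ := GRing.Zmodule_isLmodule.Build K tensor
  tensor_scaleA tensor_scale1 tensor_scaleDr tensor_scaleDl.

Definition tpure (u : U) (v : V) : tensor := \pi_tensor [:: (u, v)].

Lemma lift_fun_pure (W : lmodType K) (b : {bilinear U -> V -> W}) u v :
  tensor_lift_fun b (tpure u v) = b u v.
Proof. by rewrite /tensor_lift_fun bil_sum_repr /bil_sum big_seq1. Qed.

Lemma tpure_bilinear : bilinear_for *:%R *:%R tpure.
Proof.
split=> w a x y; apply: tensor_ext => W b.
  by rewrite lift_funD lift_funZ !lift_fun_pure linearPl.
by rewrite lift_funD lift_funZ !lift_fun_pure linearPr.
Qed.

HB.instance Definition _ :=
  bilinear_isBilinear.Build K U V tensor _ _ tpure tpure_bilinear.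

Definition tlift (W : lmodType K) (b : {bilinear U -> V -> W}) : tensor -> W :=
  tensor_lift_fun b.

Lemma tlift_linear (W : lmodType K) (b : {bilinear U -> V -> W}) :
  linear (tlift b).
Proof. by move=> a x y; rewrite /tlift lift_funD lift_funZ. Qed.

HB.instance Definition _ (W : lmodType K) (b : {bilinear U -> V -> W}) :=
  GRing.isLinear.Build K tensor W _ (tlift b) (tlift_linear b).

Lemma tliftE (W : lmodType K) (b : {bilinear U -> V -> W}) u v :
  tlift b (tpure u v) = b u v.
Proof. exact: lift_fun_pure. Qed.

Lemma tensor_sum_pure (x : tensor) :
  x = \sum_(p <- repr x) tpure p.1 p.2.
Proof.
apply: tensor_ext => W b; rewrite -/(tlift b _) -/(tlift b (\sum_(p <- _) _)).
rewrite linear_sum; apply: eq_bigr => p _ /=; by rewrite tliftE.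
Qed.

Lemma tensor_ind (P : tensor -> Prop) :
  (forall u v, P (tpure u v)) -> P 0 ->
  (forall x y, P x -> P y -> P (x + y)) -> forall x, P x.
Proof.
move=> Ppure P0 PD x; rewrite (tensor_sum_pure x).
by elim/big_ind: _ => // p _.
Qed.

Lemma tensor_linear_ext (W : lmodType K) (f g : {linear tensor -> W}) :
  (forall u v, f (tpure u v) = g (tpure u v)) -> f =1 g.
Proof.
move=> fg; apply: tensor_ind => //; first by rewrite !linear0.
by move=> x y fx fy; rewrite !linearD fx fy.
Qed.

End TensorProduct.

Notation "U ⨂ V" := (tensor U V) (at level 40, left associativity).
Notation "u ⊗ v" := (tpure u v) (at level 40, left associativity) : ring_scope.

Section TensorMaps.
Variable K : fieldType.
Implicit Types U V W X : lmodType K.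

Definition tmap_bil U V W X (f : {linear U -> W}) (g : {linear V -> X})
  (u : U) (v : V) : W ⨂ X := f u ⊗ g v.

Lemma tmap_bilP U V W X (f : {linear U -> W}) (g : {linear V -> X}) :
  bilinear_for *:%R *:%R (tmap_bil f g).
Proof.
by split=> w a x y; rewrite /tmap_bil linearP ?linearPl ?linearPr.
Qed.

HB.instance Definition _ U V W X (f : {linear U -> W}) (g : {linear V -> X}) :=
  bilinear_isBilinear.Build K U V _ _ _ (tmap_bil f g) (tmap_bilP f g).

Definition tmap U V W X (f : {linear U -> W}) (g : {linear V -> X}) :
  {linear U ⨂ V -> W ⨂ X} := tlift (tmap_bil f g).

Lemma tmapE U V W X (f : {linear U -> W}) (g : {linear V -> X}) u v :
  tmap f g (u ⊗ v) = f u ⊗ g v.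
Proof. exact: tliftE. Qed.

Definition tswap_bil U V (u : U) (v : V) : V ⨂ U := v ⊗ u.

Lemma tswap_bilP U V : bilinear_for *:%R *:%R (@tswap_bil U V).
Proof. by split=> w a x y; rewrite /tswap_bil ?linearPl ?linearPr. Qed.

HB.instance Definition _ U V :=
  bilinear_isBilinear.Build K U V _ _ _ (@tswap_bil U V) (@tswap_bilP U V).

Definition tswap U V : {linear U ⨂ V -> V ⨂ U} := tlift (@tswap_bil U V).

Lemma tswapE U V (u : U) (v : V) : tswap U V (u ⊗ v) = v ⊗ u.
Proof. exact: tliftE. Qed.

Definition scale_l_bil U (a : K^o) (u : U) : U := a *: u.
Definition scale_r_bil U (u : U) (a : K^o) : U := a *: u.

Lemma scale_l_bilP U : bilinear_for *:%R *:%R (@scale_l_bil U).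
Proof.
split=> w a x y; rewrite /scale_l_bil.
  by rewrite scalerDl; congr (_ + _); exact: (esym (scalerA _ _ _)).
by rewrite scalerDr scalerA mulrC; congr (_ + _); exact: (esym (scalerA _ _ _)).
Qed.

Lemma scale_r_bilP U : bilinear_for *:%R *:%R (@scale_r_bil U).
Proof.
split=> w a x y; rewrite /scale_r_bil; last first.
  by rewrite scalerDl; congr (_ + _); exact: (esym (scalerA _ _ _)).
by rewrite scalerDr scalerA mulrC; congr (_ + _); exact: (esym (scalerA _ _ _)).
Qed.

HB.instance Definition _ U :=
  bilinear_isBilinear.Build K _ U U _ _ (@scale_l_bil U) (@scale_l_bilP U).
HB.instance Definition _ U :=
  bilinear_isBilinear.Build K U _ U _ _ (@scale_r_bil U) (@scale_r_bilP U).

Definition tunit_l U : {linear K^o ⨂ U -> U} := tlift (@scale_l_bil U).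
Definition tunit_r U : {linear U ⨂ K^o -> U} := tlift (@scale_r_bil U).

Lemma tunit_lE U (a : K^o) (u : U) : tunit_l U (a ⊗ u) = a *: u.
Proof. exact: tliftE. Qed.

Lemma tunit_rE U (a : K^o) (u : U) : tunit_r U (u ⊗ a) = a *: u.
Proof. exact: tliftE. Qed.

Definition tpure_l U V (u : U) : V -> U ⨂ V := fun v => u ⊗ v.
Definition tpure_r U V (v : V) : U -> U ⨂ V := fun u => u ⊗ v.

Lemma tpure_l_linear U V (u : U) : linear (@tpure_l U V u).
Proof. by move=> a x y; rewrite /tpure_l linearPr. Qed.

Lemma tpure_r_linear U V (v : V) : linear (@tpure_r U V v).
Proof. by move=> a x y; rewrite /tpure_r linearPl. Qed.

HB.instance Definition _ U V (u : U) :=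
  GRing.isLinear.Build K V (U ⨂ V) _ (@tpure_l U V u) (tpure_l_linear u).
HB.instance Definition _ U V (v : V) :=
  GRing.isLinear.Build K U (U ⨂ V) _ (@tpure_r U V v) (tpure_r_linear v).

Definition tassoc_bil U V W (s : U ⨂ V) (w : W) : U ⨂ (V ⨂ W) :=
  tmap idfun (tpure_r w) s.

Definition tassocV_bil U V W (u : U) (s : V ⨂ W) : (U ⨂ V) ⨂ W :=
  tmap (tpure_l u) idfun s.

Lemma tassoc_bilP U V W : bilinear_for *:%R *:%R (@tassoc_bil U V W).
Proof.
split=> [w|s] a x y; rewrite /tassoc_bil; first by rewrite linearP.
elim/tensor_ind: s => [u v||s t]; first by rewrite !tmapE /= /tpure_r !linearPr.
  by rewrite !linear0 /= scaler0 addr0.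
by move=> hs ht; rewrite !linearD hs ht /= scalerDr addrACA.
Qed.

Lemma tassocV_bilP U V W : bilinear_for *:%R *:%R (@tassocV_bil U V W).
Proof.
split=> [s|u] a x y; rewrite /tassocV_bil; last by rewrite linearP.
elim/tensor_ind: s => [v w||s t]; first by rewrite !tmapE /= /tpure_l !linearPl.
  by rewrite !linear0 /= scaler0 addr0.
by move=> hs ht; rewrite !linearD hs ht /= scalerDr addrACA.
Qed.

HB.instance Definition _ U V W :=
  bilinear_isBilinear.Build K _ W _ _ _ (@tassoc_bil U V W) (@tassoc_bilP U V W).
HB.instance Definition _ U V W :=
  bilinear_isBilinear.Build K U _ _ _ _ (@tassocV_bil U V W)
    (@tassocV_bilP U V W).

Definition tassoc U V W : {linear (U ⨂ V) ⨂ W -> U ⨂ (V ⨂ W)} :=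
  tlift (@tassoc_bil U V W).
Definition tassocV U V W : {linear U ⨂ (V ⨂ W) -> (U ⨂ V) ⨂ W} :=
  tlift (@tassocV_bil U V W).

Lemma tassocE U V W (u : U) (v : V) (w : W) :
  tassoc U V W ((u ⊗ v) ⊗ w) = u ⊗ (v ⊗ w).
Proof. by rewrite [LHS]tliftE [LHS]tmapE. Qed.

Lemma tassocVE U V W (u : U) (v : V) (w : W) :
  tassocV U V W (u ⊗ (v ⊗ w)) = (u ⊗ v) ⊗ w.
Proof. by rewrite [LHS]tliftE [LHS]tmapE. Qed.

(* The threefold tensor power is bracketed as (U ⨂ U) ⨂ U. *)
Definition sigma U : {linear (U ⨂ U) ⨂ U -> (U ⨂ U) ⨂ U} :=
  tassocV U U U \o tswap (U ⨂ U) U.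

Definition tau23 U : {linear (U ⨂ U) ⨂ U -> (U ⨂ U) ⨂ U} :=
  tassocV U U U \o tmap idfun (tswap U U) \o tassoc U U U.

Lemma sigmaE U (x y z : U) : sigma U (x ⊗ y ⊗ z) = z ⊗ x ⊗ y.
Proof. by rewrite /sigma /= tswapE tassocVE. Qed.

Lemma tau23E U (x y z : U) : tau23 U (x ⊗ y ⊗ z) = x ⊗ z ⊗ y.
Proof. by rewrite /tau23 /= tassocE tmapE tswapE tassocVE. Qed.

(* tau_23 on the fourfold tensor power, bracketed as (U ⨂ U) ⨂ (U ⨂ U). *)
Definition tau23_4 U : {linear (U ⨂ U) ⨂ (U ⨂ U) -> (U ⨂ U) ⨂ (U ⨂ U)} :=
  tassoc (U ⨂ U) U U \o tmap (tau23 U) idfun \o tassocV (U ⨂ U) U U.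

Lemma tau23_4E U (x y z t : U) :
  tau23_4 U ((x ⊗ y) ⊗ (z ⊗ t)) = (x ⊗ z) ⊗ (y ⊗ t).
Proof. by rewrite /tau23_4 /= tassocVE tmapE tau23E tassocE. Qed.

End TensorMaps.

Section Structures.
Variables (K : fieldType) (A : lmodType K).
Implicit Types (mu br : {linear A ⨂ A -> A}) (one : A).
Implicit Types (Delta delta : {linear A -> A ⨂ A}) (eps : {linear A -> K^o}).
Implicit Types (alpha S : {linear A -> A}).

Record hom_associative mu alpha : Prop := HomAssociative {
  mu_multiplicative : forall x y, alpha (mu (x ⊗ y)) = mu (alpha x ⊗ alpha y);
  mu_assoc : forall x y z,
    mu (mu (x ⊗ y) ⊗ alpha z) = mu (alpha x ⊗ mu (y ⊗ z))
}.

Definition hom_unital mu one alpha : Prop :=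
  forall x, mu (one ⊗ x) = alpha x /\ mu (x ⊗ one) = alpha x.

Record hom_Lie br alpha : Prop := HomLie {
  br_multiplicative : forall x y, alpha (br (x ⊗ y)) = br (alpha x ⊗ alpha y);
  br_skew : forall x y, br (x ⊗ y) = - br (y ⊗ x);
  br_jacobi : forall x y z,
    br (alpha x ⊗ br (y ⊗ z)) + br (alpha y ⊗ br (z ⊗ x))
      + br (alpha z ⊗ br (x ⊗ y)) = 0
}.

Record hom_coassociative Delta alpha : Prop := HomCoassociative {
  Delta_multiplicative : forall x,
    tmap alpha alpha (Delta x) = Delta (alpha x);
  Delta_coassoc : forall x,
    tassocV A A A (tmap alpha Delta (Delta x)) = tmap Delta alpha (Delta x)
}.

Definition hom_counital Delta eps alpha : Prop :=
  forall x, tunit_r A (tmap idfun eps (Delta x)) = alpha x /\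
            tunit_l A (tmap eps idfun (Delta x)) = alpha x.

Record hom_bialgebra mu one Delta eps alpha : Prop := HomBialgebra {
  bialg_assoc : hom_associative mu alpha;
  bialg_unital : hom_unital mu one alpha;
  bialg_coassoc : hom_coassociative Delta alpha;
  bialg_counital : hom_counital Delta eps alpha;
  bialg_Delta1 : Delta one = one ⊗ one;
  bialg_DeltaM : forall x y,
    Delta (mu (x ⊗ y)) = tmap mu mu (tau23_4 A (Delta x ⊗ Delta y));
  bialg_eps1 : eps one = 1;
  bialg_epsM : forall x y, eps (mu (x ⊗ y)) = (eps x : K) * eps y;
  bialg_eps_alpha : forall x, eps (alpha x) = eps x
}.

Definition convolution mu Delta (f g : {linear A -> A}) : {linear A -> A} :=
  mu \o tmap f g \o Delta.

Definition hom_antipode mu one Delta eps S : Prop :=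
  forall x, convolution mu Delta S idfun x = eps x *: one /\
            convolution mu Delta idfun S x = eps x *: one.

Definition hom_Hopf mu one Delta eps alpha S : Prop :=
  hom_bialgebra mu one Delta eps alpha /\ hom_antipode mu one Delta eps S.

Record hom_coPoisson Delta eps alpha delta : Prop := HomCoPoisson {
  coP_coassoc : hom_coassociative Delta alpha;
  coP_counital : hom_counital Delta eps alpha;
  coP_cocomm : forall x, tswap A A (Delta x) = Delta x;
  coP_multiplicative : forall x, tmap alpha alpha (delta x) = delta (alpha x);
  coP_skew : forall x, tswap A A (delta x) = - delta x;
  coP_jacobi : forall x,
    let t := tassocV A A A (tmap alpha delta (delta x)) in
    t + sigma A t + sigma A (sigma A t) = 0;
  coP_leibniz : forall x,
    tmap Delta alpha (delta x) =
      tassocV A A A (tmap alpha delta (Delta x))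
      + tau23 A (tmap delta alpha (Delta x))
}.

Definition coPoisson_compat mu Delta delta : Prop :=
  forall x y, delta (mu (x ⊗ y)) =
    tmap mu mu (tau23_4 A (delta x ⊗ Delta y + Delta x ⊗ delta y)).

Definition hom_coPoisson_bialgebra mu one Delta eps alpha delta : Prop :=
  [/\ hom_coPoisson Delta eps alpha delta,
      hom_bialgebra mu one Delta eps alpha
    & coPoisson_compat mu Delta delta].

Definition hom_coPoisson_Hopf mu one Delta eps alpha delta S : Prop :=
  [/\ hom_coPoisson Delta eps alpha delta,
      hom_Hopf mu one Delta eps alpha S
    & coPoisson_compat mu Delta delta].

Record hom_Poisson mu br alpha : Prop := HomPoisson {
  P_assoc : hom_associative mu alpha;
  P_comm : forall x y, mu (x ⊗ y) = mu (y ⊗ x);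
  P_Lie : hom_Lie br alpha;
  P_leibniz : forall x y z,
    br (mu (x ⊗ y) ⊗ alpha z)
    = mu (alpha x ⊗ br (y ⊗ z)) + mu (br (x ⊗ z) ⊗ alpha y)
}.

(* tensor_bracket (a1 ⊗ a2 ⊗ (b1 ⊗ b2)) =
     {a1, b1} ⊗ a2 b2 + a1 b1 ⊗ {a2, b2} *)
Definition tensor_bracket mu br (t : (A ⨂ A) ⨂ (A ⨂ A)) : A ⨂ A :=
  tmap br mu (tau23_4 A t) + tmap mu br (tau23_4 A t).

Definition Poisson_compat mu Delta br : Prop :=
  forall x y, Delta (br (x ⊗ y)) = tensor_bracket mu br (Delta x ⊗ Delta y).

Definition hom_Poisson_bialgebra mu one Delta eps alpha br : Prop :=
  [/\ hom_Poisson mu br alpha,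
      hom_bialgebra mu one Delta eps alpha
    & Poisson_compat mu Delta br].

Definition hom_Poisson_Hopf mu one Delta eps alpha br S : Prop :=
  [/\ hom_Poisson mu br alpha,
      hom_Hopf mu one Delta eps alpha S
    & Poisson_compat mu Delta br].

Definition is_subspace (P : A -> Prop) : Prop :=
  P 0 /\ forall (a : K) x y, P x -> P y -> P (a *: x + y).

(* The unital subalgebra generated by the x_i is A. It is closed under alpha, *)
(* as alpha a = 1 a in the structures considered.                             *)
Definition generates mu one (n : nat) (x : 'I_n -> A) : Prop :=
  forall P : A -> Prop, is_subspace P -> P one -> (forall i, P (x i)) ->
    (forall a b, P a -> P b -> P (mu (a ⊗ b))) -> forall a, P a.

Definition almost_normalizing mu one : Prop :=
  exists (n : nat) (x : 'I_n -> A), generates mu one x /\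
    forall i j, exists (c : 'I_n -> K) (d : K),
      mu (x i ⊗ x j) - mu (x j ⊗ x i) = \sum_l c l *: x l + d *: one.

Record is_ideal mu (I : A -> Prop) : Prop := IsIdeal {
  ideal_subspace : is_subspace I;
  ideal_mull : forall a x, I x -> I (mu (a ⊗ x));
  ideal_mulr : forall a x, I x -> I (mu (x ⊗ a))
}.

(* A / I is spanned by the classes of finitely many vectors. *)
Definition cofinite (I : A -> Prop) : Prop :=
  exists (n : nat) (e : 'I_n -> A), forall x, exists c : 'I_n -> K,
    I (x - \sum_i c i *: e i).

Lemma subspace_sum (I : A -> Prop) n (c : 'I_n -> K) (e : 'I_n -> A) :
  is_subspace I -> (forall i, I (e i)) -> I (\sum_i c i *: e i).
Proof.
case=> I0 IP Ie; elim/big_ind: _ => // [x y Ix Iy|i _].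
  by rewrite -[x]scale1r; apply: IP.
by rewrite -[_ *: _]addr0; apply: IP.
Qed.

Lemma cofiniteP (I : A -> Prop) : is_subspace I -> cofinite I ->
  exists (n : nat) (p : {linear A -> 'rV[K]_n}), forall x, I x <-> p x = 0.
Proof.
move=> Isub; have [I0 IP] := Isub.
have IB x y : I x -> I y -> I (x - y).
  by move=> Ix Iy; rewrite addrC -scaleN1r; apply: IP.
pose P n := `[< exists e : 'I_n -> A, forall x, exists c : 'I_n -> K,
  I (x - \sum_i c i *: e i) >].
move=> [n0 cof0]; have exP : exists n, P n by exists n0; apply/asboolP.
case: (ex_minnP exP) => n /asboolP[e spane] minn.
have freee (c : 'I_n -> K) : I (\sum_i c i *: e i) -> forall i, c i = 0.
  move=> Ic k; apply/eqP; apply: contraT => ck0.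
  case: n => [|m] in e spane minn c Ic k ck0 *; first by case: k {ck0}.
  suff /minn : P m by rewrite ltnn.
  apply/asboolP; exists (fun j => e (lift k j)) => x.
  have [d Id] := spane x; pose r := d k / c k.
  exists (fun j => d (lift k j) - r * c (lift k j)).
  have -> : x - \sum_j (d (lift k j) - r * c (lift k j)) *: e (lift k j) =
            r *: (\sum_i c i *: e i) + (x - \sum_i d i *: e i).
    rewrite addrCA; congr (_ + _); rewrite !(bigD1_ord k) //= scalerDr scalerA.
    rewrite divfK // opprD addrACA subrr add0r scaler_sumr -sumrB -sumrN.
    by apply: eq_bigr => j _; rewrite scalerA scalerBl opprB.
  exact: IP.
have [c Ic] := choice spane.
pose p x : 'rV[K]_n := \row_i c x i.
have cE x (d : 'I_n -> K) : I (x - \sum_i d i *: e i) -> p x = \row_i d i.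
  move=> Id; apply/rowP => i; rewrite !mxE; apply/eqP; rewrite -subr_eq0.
  apply/eqP; move: i; apply: freee; have := IB _ _ Id (Ic x).
  rewrite opprB addrC addrA subrK => h; have := h.
  by under [X in _ -> I X]eq_bigr do rewrite scalerBl; rewrite sumrB.
have plin : linear p.
  move=> a x y; rewrite (cE _ (fun i => a * c x i + c y i)).
    by apply/rowP => i; rewrite !mxE.
  under eq_bigr do rewrite scalerDl -scalerA.
  rewrite big_split /= -scaler_sumr opprD addrACA -scalerBr.
  exact: IP.
pose pL : {linear A -> 'rV[K]_n} :=
  HB.pack p (GRing.isLinear.Build K A _ _ p plin).
exists n, pL => x /=.
split=> [Ix|px0].
  rewrite (cE x (fun=> 0)); first by apply/rowP => i; rewrite !mxE.
  by rewrite big1 ?subr0 // => i _; rewrite scale0r.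
have := Ic x; rewrite big1 ?subr0 // => i _.
by have /rowP/(_ i) := px0; rewrite !mxE => ->; rewrite scale0r.
Qed.

Lemma cofinite_ker n (p : {linear A -> 'rV[K]_n}) (I : A -> Prop) :
  (forall x, p x = 0 -> I x) -> cofinite I.
Proof.
move=> kerI.
pose Q r := `[< exists m (e : 'I_m -> A), \rank (\matrix_i p (e i)) = r >].
have exQ : exists r, Q r.
  by exists (\rank (\matrix_(i < 0) p 0)); apply/asboolP; exists 0, (fun=> 0).
have bndQ r : Q r -> (r <= n)%N.
  by move=> /asboolP[m [e <-]]; exact: rank_leq_col.
case: (ex_maxnP exQ bndQ) => r /asboolP[m [e re]] maxr.
exists m, e => x; set M := (\matrix_i p (e i)) in re.
have /submxP[c pxE] : (p x <= M)%MS.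
  pose e' (i : 'I_(1 + m)) := if fintype.split i is inr j then e j else x.
  have M'E : \matrix_i p (e' i) = col_mx (p x) M.
    apply/matrixP => i j; rewrite !mxE /e'.
    by case: (fintype.split i) => k; rewrite ?mxE // (ord1 k).
  have /maxr : Q (\rank (col_mx (p x) M)).
    by apply/asboolP; exists (1 + m)%N, e'; rewrite M'E.
  rewrite -re -addsmxE => le.
  have [_ eqM] := mxrank_leqif_sup (addsmxSr (p x) M).
  have : (p x + M <= M)%MS by rewrite -eqM eqn_leq le mxrankS ?addsmxSr.
  by rewrite addsmx_sub => /andP[].
exists (fun i => c 0 i); apply: kerI; rewrite linearB linear_sum pxE.
apply/eqP; rewrite subr_eq0; apply/eqP/rowP => j; rewrite !mxE summxE.
by apply: eq_bigr => i _; rewrite linearZ !mxE.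
Qed.

Lemma cofiniteI (I J : A -> Prop) : is_subspace I -> is_subspace J ->
  cofinite I -> cofinite J -> cofinite (fun x => I x /\ J x).
Proof.
move=> Isub Jsub /(cofiniteP Isub)[n [p pP]] /(cofiniteP Jsub)[m [q qP]].
pose r x := row_mx (p x) (q x).
have rlin : linear r.
  by move=> a x y; rewrite /r !linearP scale_row_mx add_row_mx.
pose rL : {linear A -> 'rV[K]_(n + m)} :=
  HB.pack r (GRing.isLinear.Build K A _ _ r rlin).
apply: (@cofinite_ker _ rL).
move=> x /= /eqP; rewrite row_mx_eq0 => /andP[/eqP px /eqP qx].
by split; [apply/pP | apply/qP].
Qed.

Lemma idealI mu (I J : A -> Prop) :
  is_ideal mu I -> is_ideal mu J -> is_ideal mu (fun x => I x /\ J x).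
Proof.
case=> [[I0 IP] Il Ir] [[J0 JP] Jl Jr]; split.
- by split=> // a x y [Ix Jx] [Iy Jy]; split; [apply: IP | apply: JP].
- by move=> a x [Ix Jx]; split; [apply: Il | apply: Jl].
- by move=> a x [Ix Jx]; split; [apply: Ir | apply: Jr].
Qed.

End Structures.

(* The finite dual A° of (A, mu) *)
Section FiniteDual.
Variables (K : fieldType) (A : lmodType K) (mu : {linear A ⨂ A -> A}).

Definition fdual_pred : {pred A -> K^o} := fun f =>
  `[< linear f /\
      exists I : A -> Prop,
        [/\ is_ideal mu I, cofinite I & forall x, I x -> f x = 0] >].

Lemma fdual_submod_closed : submod_closed fdual_pred.
Proof.
split=> [|a f g /asboolP[flin [I [Iid Icof If]]] /asboolP[glin [J [Jid Jcof Jg]]]].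
  apply/asboolP; split; first by move=> a x y; rewrite scaler0 addr0.
  exists (fun=> True); split=> //.
  by exists 0, (fun=> 0) => x; exists (fun=> 0).
apply/asboolP; split.
  move=> b x y; rewrite !addrfctE !scalrfctE flin glin.
  by rewrite !scalerDr !scalerA [a * b]mulrC addrACA.
exists (fun x => I x /\ J x); split; first exact: idealI.
  by apply: cofiniteI => //; [case: Iid | case: Jid].
move=> x [Ix Jx]; rewrite addrfctE scalrfctE.
by rewrite If // Jg // scaler0 addr0.
Qed.

HB.instance Definition _ :=
  GRing.isSubmodClosed.Build K (A -> K^o) fdual_pred fdual_submod_closed.

Record fdual : Type := FDual {
  fdual_fun :> A -> K^o;
  _ : fdual_fun \in fdual_pred
}.

HB.instance Definition _ := [isSub for fdual_fun].
HB.instance Definition _ := [Choice of fdual by <:].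
HB.instance Definition _ := [SubChoice_isSubLmodule of fdual by <:].

Lemma fdual_linear (f : fdual) : linear f.
Proof. by case: f => f /= /asboolP[]. Qed.

HB.instance Definition _ (f : fdual) :=
  GRing.isLinear.Build K A K^o _ f (fdual_linear f).

(* The natural pairing between A ⨂ A and A° ⨂ A°,                             *)
(* <x ⊗ y, f ⊗ g> = f x * g y; it identifies A° ⨂ A° with (A ⨂ A)°.           *)
Definition fdual_mul (f g : fdual) (x y : A) : K^o := (f x : K) * g y.

Lemma fdual_mul_bilP f g : bilinear_for *:%R *:%R (fdual_mul f g).
Proof.
split=> w a x y; rewrite /fdual_mul linearP /=.
  by rewrite mulrDl -mulrA.
by rewrite mulrDr mulrCA.
Qed.

HB.instance Definition _ f g :=
  bilinear_isBilinear.Build K A A K^o _ _ (fdual_mul f g) (fdual_mul_bilP f g).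

Definition pairing_pure (t : A ⨂ A) (f g : fdual) : K^o :=
  tlift (fdual_mul f g) t.

Lemma pairing_pure_bilP t : bilinear_for *:%R *:%R (pairing_pure t).
Proof.
split=> w a f g; rewrite /pairing_pure; elim/tensor_ind: t => [x y||s t].
- by rewrite !tliftE /fdual_mul [LHS]mulrDl -[in LHS]mulrA.
- by rewrite !linear0 /= scaler0 addr0.
- by move=> hs ht; rewrite !linearD /= hs ht scalerDr addrACA.
- by rewrite !tliftE /fdual_mul [LHS]mulrDr; congr (_ + _); exact: mulrCA.
- by rewrite !linear0 /= scaler0 addr0.
- by move=> hs ht; rewrite !linearD /= hs ht scalerDr addrACA.
Qed.

HB.instance Definition _ t :=
  bilinear_isBilinear.Build K fdual fdual K^o _ _ (pairing_pure t)
    (pairing_pure_bilP t).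

Definition pairing (t : A ⨂ A) (F : fdual ⨂ fdual) : K^o :=
  tlift (pairing_pure t) F.

Lemma pairingE x y (f g : fdual) : pairing (x ⊗ y) (f ⊗ g) = (f x : K) * g y.
Proof. by rewrite /pairing tliftE /= /pairing_pure tliftE. Qed.

(* hd is the map h° on the finite dual: the restriction of h^* to A°, with    *)
(* values in A°.                                                              *)
Definition is_dual_map (h : {linear A -> A}) (hd : {linear fdual -> fdual}) :
  Prop := forall f x, hd f x = f (h x).

Record is_dual_bialgebra (one : A) (Delta : {linear A -> A ⨂ A})
  (eps : {linear A -> K^o}) (alpha : {linear A -> A})
  (muD : {linear fdual ⨂ fdual -> fdual}) (oneD : fdual)
  (DeltaD : {linear fdual -> fdual ⨂ fdual}) (epsD : {linear fdual -> K^o})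
  (alphaD : {linear fdual -> fdual}) : Prop := IsDualBialgebra {
  dual_mul : forall f g x,
    muD (f ⊗ g) x = pairing (Delta x) (f ⊗ g);
  dual_one : forall x, oneD x = eps x;
  dual_Delta : forall f x y, pairing (x ⊗ y) (DeltaD f) = f (mu (x ⊗ y));
  dual_eps : forall f : fdual, epsD f = f one;
  dual_alpha : is_dual_map alpha alphaD
}.

Definition is_dual_bracket (delta : {linear A -> A ⨂ A})
  (brD : {linear fdual ⨂ fdual -> fdual}) : Prop :=
  forall f g x, brD (f ⊗ g) x = pairing (delta x) (f ⊗ g).

End FiniteDual.

(* Main.v *)
(* For f, g in A°, both vanishing on a cofinite ideal I, let D and d be the   *)
(* maps A -> (A/I) ⨂ (A/I) induced by Delta and delta. As D is a morphism and *)
(* d is a D-derivation, ker D ∩ ker d is a cofinite ideal of A: it is the     *)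
(* kernel of the morphism [D d; 0 D] to upper triangular matrices. The        *)
(* product and the bracket of f and g vanish on it, hence lie in A°. The      *)
(* identities of A° are then the transposes of those of A, the ones that live *)
(* in tensor powers of A° being tested on pure tensors of A.                  *)
From HB Require Import structures.
Require Import Defs.
From mathcomp Require Import all_boot all_algebra.
From mathcomp Require Import boolp.
From mathcomp Require Import ring.

Set Implicit Arguments.
Unset Strict Implicit.
Unset Printing Implicit Defensive.

Import GRing.Theory.
Local Open Scope ring_scope.

(** Every structure map of A° is the transpose of one of A, so two things need an argument: that the
    transposes take values in A°, and that axioms whose values lie in tensor powers of A° can be
    checked on points of A.

    For the first, let f and g vanish on a cofinite ideal I, and let N be the kernel of A ⊗ A -> A/I
    ⊗ A/I. Since N absorbs componentwise products ([tform_mu_vanish]), the rules Delta(xy) =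
    Delta(x) Delta(y) and delta(xy) = delta(x) Delta(y) + Delta(x) delta(y) make the set of x with
    Delta(x) and delta(x) both in N an ideal. Its quotient embeds in two copies of A/I ⊗ A/I, so it
    is cofinite, and f ⊗ g vanishes on N ([dual_op_vanish]).

    For the second, A° ⊗ A° and A° ⊗ A° ⊗ A° are separated by pure tensors of A
    ([tform_separating]). The axioms then follow by transposition: [dual_op_hom_assoc_l] and
    [dual_op_hom_assoc_r] handle the ternary identities, [pairing_dual_coproductM] the compatibility
    of products and brackets with coproducts. *)

(* Locked because unification would otherwise read it as a composite. *)
HB.lock Definition tform (K : fieldType) (U V : lmodType K)
  (phi : {linear U -> K^o}) (psi : {linear V -> K^o}) :
  {linear U ⨂ V -> K^o} := tunit_l K^o \o tmap phi psi.

(** * Tensor products of linear forms *)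

Section TensorForms.
Variable K : fieldType.
Implicit Types U V W X : lmodType K.

Lemma lcompE U V W (f : {linear V -> W}) (g : {linear U -> V}) x :
  (f \o g : {linear U -> W}) x = f (g x).
Proof. by []. Qed.

Lemma tformE U V (phi : {linear U -> K^o}) (psi : {linear V -> K^o}) u v :
  tform phi psi (u ⊗ v) = (phi u : K) * psi v.
Proof. by rewrite tform.unlock lcompE tmapE tunit_lE. Qed.

Lemma eq_tform U V (phi phi' : {linear U -> K^o}) (psi psi' : {linear V -> K^o}) :
  phi =1 phi' -> psi =1 psi' -> tform phi psi =1 tform phi' psi'.
Proof.
by move=> ephi epsi; apply: tensor_linear_ext => u v; rewrite !tformE ephi epsi.
Qed.

Lemma tform_tmap U V W X (phi : {linear W -> K^o}) (psi : {linear X -> K^o})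
  (h : {linear U -> W}) (k : {linear V -> X}) t :
  tform phi psi (tmap h k t) = tform (phi \o h) (psi \o k) t.
Proof.
elim/tensor_ind: t => [u v||s t hs ht]; first by rewrite tmapE !tformE.
  by rewrite !linear0.
by rewrite !linearD hs ht.
Qed.

Lemma tform_tassocV U V W (phi : {linear U -> K^o}) (psi : {linear V -> K^o})
  (chi : {linear W -> K^o}) t :
  tform (tform phi psi) chi (tassocV U V W t) = tform phi (tform psi chi) t.
Proof.
elim/tensor_ind: t => [u s||s t hs ht]; last by rewrite !linearD hs ht.
  elim/tensor_ind: s => [v w||s t hs ht].
  - by rewrite tassocVE !tformE mulrA.
  - by rewrite linear0r !linear0.
  - by rewrite linearDr !linearD hs ht.
by rewrite !linear0.
Qed.

Lemma tform_tswap U V (phi : {linear U -> K^o}) (psi : {linear V -> K^o}) t :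
  tform psi phi (tswap U V t) = tform phi psi t.
Proof.
elim/tensor_ind: t => [u v||s t hs ht]; first by rewrite tswapE !tformE mulrC.
  by rewrite !linear0.
by rewrite !linearD hs ht.
Qed.

Lemma tform_sigma U (phi psi chi : {linear U -> K^o}) t :
  tform (tform phi psi) chi (sigma U t) = tform (tform psi chi) phi t.
Proof. by rewrite /sigma lcompE tform_tassocV tform_tswap. Qed.

Lemma tform_tau23 U (phi psi chi : {linear U -> K^o}) t :
  tform (tform phi psi) chi (tau23 U t) = tform (tform phi chi) psi t.
Proof.
elim/tensor_ind: t => [s w||s t hs ht]; last by rewrite !linearD hs ht.
  elim/tensor_ind: s => [u v||s t hs ht].
  - by rewrite tau23E !tformE -!mulrA [psi w * _]mulrC.
  - by rewrite linear0l !linear0.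
  - by rewrite linearDl !linearD hs ht.
by rewrite !linear0.
Qed.

(** This gives injectivity of A° ⊗ A° -> (A ⊗ A)^* without bases: a sum of pure tensors killed by
    all product forms can be rewritten with one term fewer, until none is left. *)
Lemma tform_separating U V (X Y : Type)
  (phi : X -> {linear U -> K^o}) (psi : Y -> {linear V -> K^o}) :
  (forall u, (forall x, phi x u = 0) -> u = 0) ->
  (forall v, (forall y, psi y v = 0) -> v = 0) ->
  forall t, (forall x y, tform (phi x) (psi y) t = 0) -> t = 0.
Proof.
move=> sepU sepV t; rewrite (tensor_sum_pure t).
move: {t}(repr t) => s; have [n] := ubnP (size s).
elim: n s => // n IHn [|[u v] s] /= szs t0; first by rewrite big_nil.
have [[x ax0]|nx] := pselect (exists x, phi x u <> 0); last first.
  have u0 : u = 0.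
    by apply: sepU => x; apply: contra_notP nx => ux; exists x.
  have E : \sum_(p <- (u, v) :: s) p.1 ⊗ p.2 = \sum_(p <- s) p.1 ⊗ p.2.
    by rewrite big_cons /= u0 linear0l add0r.
  by rewrite E; apply: IHn => // x y; rewrite -E.
pose a : K := phi x u; have {ax0} a0 : a != 0 by apply/eqP.
pose r (p : U * V) : K := (phi x p.1 : K) / a.
(* Contracting the first factor with [phi x] gives a vector killed by every [psi y], hence zero;
   dividing by [a] solves for [v]. *)
have ev : v = - \sum_(p <- s) r p *: p.2.
  apply/eqP; rewrite -addr_eq0; apply/eqP/sepV => y.
  have := t0 x y; rewrite linear_sum big_cons /= tformE -/a => xy0.
  apply: (mulfI a0); rewrite mulr0 -[RHS]xy0 linearD linear_sum /= mulrDr mulr_sumr.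
  congr (_ + _); apply: eq_bigr => p _; rewrite tformE linearZ /= /r.
  by rewrite /GRing.scale /= mulrA mulrCA divff // mulr1.
(* Substituting for [v] absorbs the head pair into the first factors of the others. *)
have E : \sum_(p <- (u, v) :: s) p.1 ⊗ p.2
       = \sum_(p <- [seq (p.1 - r p *: u, p.2) | p <- s]) p.1 ⊗ p.2.
  rewrite big_cons /= big_map {1}ev linearNr linear_sum /=.
  rewrite addrC -sumrB; apply: eq_bigr => p _.
  by rewrite linearBl /= linearZl_LR /= linearZr_LR.
by rewrite E; apply: IHn => [|x' y]; rewrite ?size_map // -E.
Qed.

End TensorForms.

(** * The finite dual, its evaluations and its pairing with A ⊗ A *)

Section FiniteDualTheory.
Variables (K : fieldType) (A : lmodType K) (mu : {linear A ⨂ A -> A}).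
Local Notation Ao := (fdual mu).
Implicit Types (f g h : Ao) (F G : Ao ⨂ Ao) (s t : A ⨂ A) (I : A -> Prop).

Lemma fdual_ext f g : f =1 g -> f = g.
Proof. by move=> fg; apply/val_inj/funext. Qed.

Lemma fdual_vanish f :
  exists I, [/\ is_ideal mu I, cofinite I & forall x, I x -> f x = 0].
Proof. by case: f => f /= /asboolP[]. Qed.

Lemma fdualP (phi : {linear A -> K^o}) I : is_ideal mu I -> cofinite I ->
  (forall x, I x -> phi x = 0) -> exists f : Ao, f =1 phi.
Proof.
move=> Iid Icof Iphi.
have phiP : (phi : A -> K^o) \in fdual_pred mu.
  by apply/asboolP; split; [exact: linearP | exists I].
by exists (FDual phiP).
Qed.

Definition fdual_ev (x : A) : Ao -> K^o := fun f => f x.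

Lemma fdual_ev_linear x : linear (fdual_ev x).
Proof. by []. Qed.

HB.instance Definition _ x :=
  GRing.isLinear.Build K Ao K^o _ (fdual_ev x) (fdual_ev_linear x).

Lemma fdual_ev_separating f : (forall x, fdual_ev x f = 0) -> f = 0.
Proof. by move=> f0; apply: fdual_ext. Qed.

HB.instance Definition _ t :=
  GRing.isLinear.Build K (Ao ⨂ Ao) K^o _ (pairing t)
    (tlift_linear (pairing_pure t)).

Lemma pairing_linE t F : (pairing t : {linear Ao ⨂ Ao -> K^o}) F = pairing t F.
Proof. by []. Qed.

Lemma pairing_tform t f g : pairing t (f ⊗ g) = tform f g t.
Proof.
rewrite /pairing tliftE /= /pairing_pure.
by apply: tensor_linear_ext t => x y; rewrite [LHS]tliftE tformE.
Qed.

Lemma pairing_ev x y F : pairing (x ⊗ y) F = tform (fdual_ev x) (fdual_ev y) F.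
Proof. by apply: tensor_linear_ext F => f g; rewrite [LHS]pairingE tformE. Qed.

Lemma pairingP a s t F : pairing (a *: s + t) F = a *: pairing s F + pairing t F.
Proof.
elim/tensor_ind: F => [f g||F G hF hG]; first by rewrite !pairing_tform linearP.
  by rewrite !linear0 addr0.
by rewrite !linearD /= hF hG addrACA.
Qed.

Lemma pairing0l F : pairing 0 F = 0.
Proof. by have := pairingP (-1) 0 0 F; rewrite scaleN1r oppr0 addr0 scaleN1r addNr. Qed.

Lemma pairingDl s t F : pairing (s + t) F = pairing s F + pairing t F.
Proof. by rewrite -[s in LHS]scale1r pairingP scale1r. Qed.

Lemma fdual_tensor_ext F G :
  (forall x y, pairing (x ⊗ y) F = pairing (x ⊗ y) G) -> F = G.
Proof.
move=> FG; apply/eqP; rewrite -subr_eq0; apply/eqP.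
apply: (tform_separating fdual_ev_separating fdual_ev_separating) => x y.
by rewrite -pairing_ev linearB /= FG subrr.
Qed.

Lemma fdual_tensor3_ext (F G : Ao ⨂ Ao ⨂ Ao) :
  (forall x y z, tform (tform (fdual_ev x) (fdual_ev y)) (fdual_ev z) F =
                 tform (tform (fdual_ev x) (fdual_ev y)) (fdual_ev z) G) ->
  F = G.
Proof.
move=> FG; apply/eqP; rewrite -subr_eq0; apply/eqP.
pose ev2 (p : A * A) := tform (fdual_ev p.1) (fdual_ev p.2).
apply: (@tform_separating _ _ _ _ _ ev2 _ _ fdual_ev_separating).
  move=> H H0; apply: fdual_tensor_ext => x y.
  by rewrite pairing_ev linear0; exact: (H0 (x, y)).
by move=> [x y] z; rewrite linearB FG subrr.
Qed.

Lemma pairing_tmap (u v : {linear A -> A}) (ud vd : {linear Ao -> Ao}) t F :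
  is_dual_map u ud -> is_dual_map v vd ->
  pairing t (tmap ud vd F) = pairing (tmap u v t) F.
Proof.
move=> udE vdE; elim/tensor_ind: F => [f g||F G hF hG].
- rewrite tmapE !pairing_tform tform_tmap; apply: eq_tform => x /=.
    exact: udE.
  exact: vdE.
- by rewrite !linear0.
- by rewrite !linearD; congr (_ + _).
Qed.

(** The middle interchange on A° can be moved to the points: evaluating its result at (a, b; c, d)
    evaluates the original tensors at (a, c) and (b, d). *)
Lemma pairing_tau23_4 a b c d F G :
  tform (pairing (a ⊗ b)) (pairing (c ⊗ d)) (tau23_4 Ao (F ⊗ G))
  = (pairing (a ⊗ c) F : K) * pairing (b ⊗ d) G.
Proof.
elim/tensor_ind: F => [f1 f2||F1 F2 h1 h2].
- elim/tensor_ind: G => [g1 g2||G1 G2 h1 h2].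
  + by rewrite tau23_4E tformE !pairing_linE !pairingE mulrACA.
  + by rewrite linear0r !linear0 mulr0.
  + by rewrite linearDr !linearD !pairing_linE h1 h2 mulrDr.
- by rewrite linear0l !linear0 mul0r.
- by rewrite linearDl !linearD !pairing_linE h1 h2 mulrDl.
Qed.

(** * Coordinates modulo a cofinite ideal *)

Lemma cofinite_coord I : is_subspace I -> cofinite I ->
  exists n (e : 'I_n -> A) (c : {linear A -> 'rV[K]_n}),
    (forall x, I x -> c x = 0) /\ forall x, I (x - \sum_i c x 0 i *: e i).
Proof.
move=> Isub Icof; have [n [p pP]] := cofiniteP Isub Icof.
have [m [e /choice[k eI]]] := Icof.
pose M := \matrix_i p (e i).
(* I is the kernel of [p] and the [e i] span A modulo I, so the rows of [M] span the image of [p]. A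
   pseudo-inverse of [M] then gives linear coordinates, even if the [e i] are dependent modulo I. *)
have pM x : (p x <= M)%MS.
  apply/submxP; exists (\row_i k x i).
  have /pP := eI x; rewrite linearB linear_sum => /eqP; rewrite subr_eq0 => /eqP->.
  apply/rowP => j; rewrite !mxE summxE.
  by apply: eq_bigr => i _; rewrite linearZ !mxE.
exists m, e, (mulmxr (pinvmx M) \o p); split=> [x /pP /= ->|x].
  by rewrite mul0mx.
apply/pP/eqP; rewrite linearB linear_sum /= subr_eq0; apply/eqP.
rewrite -[LHS](mulmxKpV (pM x)); apply/rowP => j; rewrite mxE summxE.
by apply: eq_bigr => i _; rewrite linearZ !mxE.
Qed.

Lemma cofinite_fdual_coord I : is_ideal mu I -> cofinite I ->
  exists n (e : 'I_n -> A) (c : 'I_n -> Ao),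
    (forall i x, I x -> c i x = 0) /\ forall x, I (x - \sum_i c i x *: e i).
Proof.
move=> Iid Icof; have [n [e [c [c0 cI]]]] := cofinite_coord (ideal_subspace Iid) Icof.
have /choice[cd cdE] (i : 'I_n) : exists f : Ao, forall x, f x = c x 0 i.
  have clin : linear (fun x => c x 0 i : K^o).
    by move=> a x y; rewrite linearP !mxE.
  pose ci : {linear A -> K^o} := HB.pack (fun x => c x 0 i : K^o)
    (GRing.isLinear.Build K A K^o _ (fun x => c x 0 i : K^o) clin).
  by apply: (@fdualP ci I) => // x /c0 /= ->; rewrite mxE.
exists n, e, cd; split=> [i x /c0 c0x|x]; first by rewrite cdE c0x mxE.
by under eq_bigr do rewrite cdE.
Qed.

Section Coordinates.
Variables (I : A -> Prop) (n : nat) (e : 'I_n -> A) (c : 'I_n -> Ao).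
Hypothesis Iid : is_ideal mu I.
Hypothesis cI : forall x, I (x - \sum_i c i x *: e i).
Variable phi : {linear A -> K^o}.
Hypothesis phi0 : forall x, I x -> phi x = 0.

Lemma vanish_expand x : phi x = \sum_i (phi (e i) : K) * c i x.
Proof.
have /eqP := phi0 (cI x); rewrite linearB subr_eq0 linear_sum => /eqP->.
by apply: eq_bigr => i _; rewrite linearZ /= mulrC.
Qed.

Lemma vanish_mu_expand x y : phi (mu (x ⊗ y)) =
  \sum_i \sum_j (phi (mu (e i ⊗ e j)) : K) * ((c i x : K) * c j y).
Proof.
have El : phi (mu (x ⊗ y)) = phi (mu ((\sum_i c i x *: e i : A) ⊗ y)).
  by apply/eqP; rewrite -subr_eq0 -!linearB -linearBl phi0 //; exact: ideal_mulr.
rewrite El linear_sumlz /= !linear_sum; apply: eq_bigr => i _.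
rewrite linearZl_LR !linearZ /=.
have Er : phi (mu (e i ⊗ y)) = phi (mu (e i ⊗ (\sum_j c j y *: e j : A))).
  by apply/eqP; rewrite -subr_eq0 -!linearB -linearBr phi0 //; exact: ideal_mull.
rewrite Er linear_sumr /= !linear_sum /=; apply: eq_bigr => j _.
rewrite linearZr_LR !linearZ /= /GRing.scale /=; ring.
Qed.

End Coordinates.

(** The common kernel of the forms [tform (c i) (c j)] plays the role of ker (A ⊗ A -> A/I ⊗ A/I); a
    componentwise product with one factor in it is killed by every [tform phi psi] with [phi] and
    [psi] vanishing on I. *)
Lemma tform_mu_vanish I n (e : 'I_n -> A) (c : 'I_n -> Ao)
  (phi psi : {linear A -> K^o}) s t :
  is_ideal mu I ->
  (forall x, I (x - \sum_i c i x *: e i)) ->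
  (forall x, I x -> phi x = 0) -> (forall x, I x -> psi x = 0) ->
  (forall i j, tform (c i) (c j) s = 0) \/ (forall i j, tform (c i) (c j) t = 0) ->
  tform phi psi (tmap mu mu (tau23_4 A (s ⊗ t))) = 0.
Proof.
move=> Iid cI phi0 psi0.
(* Modulo the ideal I, a product depends only on the coordinates of its factors, so each term
   carries one coordinate form of [s] and one of [t]. *)
have -> : tform phi psi (tmap mu mu (tau23_4 A (s ⊗ t))) =
  \sum_i \sum_j \sum_k \sum_l
     ((phi (mu (e i ⊗ e j)) : K) * psi (mu (e k ⊗ e l))) *
     ((tform (c i) (c k) s : K) * tform (c j) (c l) t).
  elim/tensor_ind: s => [x x'||s1 s2 h1 h2].
  - elim/tensor_ind: t => [y y'||t1 t2 h1 h2].
    + rewrite tau23_4E tmapE tformE.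
      rewrite (vanish_mu_expand Iid cI phi0) (vanish_mu_expand Iid cI psi0).
      rewrite mulr_suml; apply: eq_bigr => i _.
      rewrite mulr_suml; apply: eq_bigr => j _.
      rewrite mulr_sumr; apply: eq_bigr => k _.
      rewrite mulr_sumr; apply: eq_bigr => l _.
      rewrite !tformE /=; ring.
    + rewrite linear0r !linear0.
      by do 4![rewrite big1 // => ? _]; rewrite linear0 !mulr0.
    + rewrite linearDr !linearD h1 h2.
      do 4![rewrite -big_split; apply: eq_bigr => ? _ /=].
      by rewrite linearD !mulrDr.
  - rewrite linear0l !linear0.
    by do 4![rewrite big1 // => ? _]; rewrite linear0 mul0r mulr0.
  - rewrite linearDl !linearD h1 h2.
    do 4![rewrite -big_split; apply: eq_bigr => ? _ /=].
    by rewrite linearD mulrDl mulrDr.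
by case=> z0; do 4![rewrite big1 // => ? _]; rewrite z0 ?mul0r !mulr0.
Qed.

(* With delta = 0 this is the statement for the product of A° alone. *)
Lemma dual_op_vanish (Delta delta : {linear A -> A ⨂ A}) f g :
  (forall x y,
     Delta (mu (x ⊗ y)) = tmap mu mu (tau23_4 A (Delta x ⊗ Delta y))) ->
  coPoisson_compat mu Delta delta ->
  exists I, [/\ is_ideal mu I, cofinite I &
    forall x, I x -> tform f g (Delta x) = 0 /\ tform f g (delta x) = 0].
Proof.
move=> DeltaM deltaM.
have [If [Ifid Ifcof f0]] := fdual_vanish f.
have [Ig [Igid Igcof g0]] := fdual_vanish g.
pose I x := If x /\ Ig x.
have Iid : is_ideal mu I by exact: idealI.
have Icof : cofinite I by apply: cofiniteI => //; [case: Ifid | case: Igid].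
have [n [e [c [c0 cI]]]] := cofinite_fdual_coord Iid Icof.
(* [q] collects the coordinates of the image of [t] in A/I ⊗ A/I, flattened to a row vector so that
   [cofinite_ker] applies. *)
pose q t : 'rV[K]_(n * n) := mxvec (\matrix_(i, j) tform (c i) (c j) t).
have qlin : linear q.
  move=> a s t; rewrite /q -linearP; congr mxvec.
  by apply/matrixP => i j; rewrite !mxE linearP.
have qP t : q t = 0 <-> forall i j, tform (c i) (c j) t = 0.
  split=> [/eqP|t0]; last first.
    by apply/eqP; rewrite mxvec_eq0; apply/eqP/matrixP => i j; rewrite !mxE t0.
  by rewrite mxvec_eq0 => /eqP/matrixP t0 i j; have := t0 i j; rewrite !mxE.
have q0 : q 0 = 0 by apply/qP => i j; rewrite linear0.
have qD s t : q s = 0 -> q t = 0 -> q (s + t) = 0.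
  by move=> s0 t0; rewrite -[s]scale1r qlin s0 t0 scaler0 addr0.
have qM s t : q s = 0 \/ q t = 0 -> q (tmap mu mu (tau23_4 A (s ⊗ t))) = 0.
  move=> st; apply/qP => i j.
  apply: (tform_mu_vanish Iid cI (c0 i) (c0 j)).
  by case: st => /qP; [left | right].
pose J x := q (Delta x) = 0 /\ q (delta x) = 0.
exists J; split.
- split.
  + split=> [|a x y [Dx dx] [Dy dy]]; first by rewrite /J !linear0.
    by rewrite /J !linearP !qlin Dx dx Dy dy scaler0 addr0.
  (* Each term of Delta(ax) and delta(ax) has Delta(x) or delta(x) as its right factor, which [q]
     kills. *)
  + move=> a x [Dx dx]; rewrite /J DeltaM deltaM !linearD.
    by split; [|apply: qD]; apply: qM; right.
  + move=> a x [Dx dx]; rewrite /J DeltaM deltaM !linearD.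
    by split; [|apply: qD]; apply: qM; left.
- pose r x := row_mx (q (Delta x)) (q (delta x)).
  have rlin : linear r.
    by move=> a x y; rewrite /r !linearP !qlin scale_row_mx add_row_mx.
  pose rL : {linear A -> 'rV[K]_(n * n + n * n)} :=
    HB.pack r (GRing.isLinear.Build K A _ _ r rlin).
  apply: (@cofinite_ker _ _ _ rL) => x /= /eqP.
  by rewrite row_mx_eq0 => /andP[/eqP Dx /eqP dx].
(* As f and g vanish on I, f ⊗ g is a linear combination of the coordinate forms. *)
have fgE t : q t = 0 -> tform f g t = 0.
  move=> /qP t0.
  have -> : tform f g t =
      \sum_i \sum_j ((f (e i) : K) * g (e j)) * tform (c i) (c j) t.
    elim/tensor_ind: t {t0} => [x y||s t hs ht].
    - rewrite tformE (vanish_expand cI (phi := f)) => [|z [/f0 //]].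
      rewrite (vanish_expand cI (phi := g)) => [|z [_ /g0 //]].
      rewrite mulr_suml; apply: eq_bigr => i _.
      by rewrite mulr_sumr; apply: eq_bigr => j _; rewrite tformE mulrACA.
    - by rewrite linear0; do 2![rewrite big1 // => ? _]; rewrite linear0 mulr0.
    - rewrite linearD hs ht.
      do 2![rewrite -big_split; apply: eq_bigr => ? _ /=].
      by rewrite linearD mulrDr.
  by do 2![rewrite big1 // => ? _]; rewrite t0 mulr0.
by move=> x [/fgE Dx /fgE dx].
Qed.

(** * Existence of the dual structure maps *)

Lemma dual_op_exists (d : {linear A -> A ⨂ A}) :
  (forall f g, exists I, [/\ is_ideal mu I, cofinite I &
     forall x, I x -> tform f g (d x) = 0]) ->
  exists dD : {linear Ao ⨂ Ao -> Ao},
    forall f g x, dD (f ⊗ g) x = pairing (d x) (f ⊗ g).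
Proof.
move=> dI.
have /choice[b bE] (p : Ao * Ao) :
    exists h : Ao, forall x, h x = pairing (d x) (p.1 ⊗ p.2).
  have [I [Iid Icof I0]] := dI p.1 p.2.
  have [h hE] := fdualP (phi := tform p.1 p.2 \o d) Iid Icof I0.
  by exists h => x; rewrite hE pairing_tform.
pose b2 f g := b (f, g).
have b2P : bilinear_for *:%R *:%R b2.
  split=> w a f g; apply: fdual_ext => x.
    rewrite -[RHS]/(a *: (b2 f w x) + b2 g w x) /b2 !bE /= linearPl.
    exact: linearP.
  rewrite -[RHS]/(a *: (b2 w f x) + b2 w g x) /b2 !bE /= linearPr.
  exact: linearP.
pose bL : {bilinear Ao -> Ao -> Ao} :=
  HB.pack b2 (bilinear_isBilinear.Build K Ao Ao Ao _ _ b2 b2P).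
exists (tlift bL) => f g x.
by rewrite -[RHS](bE (f, g)); congr (fdual_fun _ x); exact: tliftE.
Qed.

(** If f vanishes on I, then f o u vanishes on the preimage of I under u. This is an ideal because u
    is multiplicative, and it is cofinite because its quotient embeds in A/I. *)
Lemma dual_map_exists (u : {linear A -> A}) :
  (forall x y, u (mu (x ⊗ y)) = mu (u x ⊗ u y)) ->
  exists ud : {linear Ao -> Ao}, is_dual_map u ud.
Proof.
move=> uM.
have /choice[b bE] f : exists h : Ao, forall x, h x = f (u x).
  have [I [Iid Icof f0]] := fdual_vanish f.
  apply: (@fdualP (f \o u) (I \o u)); last by move=> x; exact: f0.
    case: Iid => [[I0 IP] Il Ir]; split.
    - by split=> [|a x y Ix Iy] /=; rewrite ?linear0 ?linearP //; exact: IP.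
    - by move=> a x Ix /=; rewrite uM; exact: Il.
    - by move=> a x Ix /=; rewrite uM; exact: Ir.
  have [n [p pP]] := cofiniteP (ideal_subspace Iid) Icof.
  by apply: (@cofinite_ker _ _ _ (p \o u)) => x /pP.
have blin : linear b.
  move=> a f g; apply: fdual_ext => x.
  by rewrite -[RHS]/(a *: (b f x) + b g x) !bE.
pose bL : {linear Ao -> Ao} := HB.pack b (GRing.isLinear.Build K Ao Ao _ b blin).
by exists bL => f x; exact: bE.
Qed.

Lemma dual_coproduct_exists :
  exists DeltaD : {linear Ao -> Ao ⨂ Ao},
    forall f x y, pairing (x ⊗ y) (DeltaD f) = f (mu (x ⊗ y)).
Proof.
have /choice[b bE] f : exists F, forall x y, pairing (x ⊗ y) F = f (mu (x ⊗ y)).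
  have [I [Iid Icof f0]] := fdual_vanish f.
  have [n [e [c [c0 cI]]]] := cofinite_fdual_coord Iid Icof.
  (* This is the coordinate expansion of f(xy), read as a tensor in A° ⊗ A°. It is the only possible
     value by [fdual_tensor_ext], which also gives linearity below. *)
  exists (\sum_i \sum_j (f (mu (e i ⊗ e j)) : K) *: (c i ⊗ c j)) => x y.
  rewrite (vanish_mu_expand Iid cI f0) linear_sum; apply: eq_bigr => i _.
  by rewrite linear_sum; apply: eq_bigr => j _; rewrite linearZ /= pairingE.
have blin : linear b.
  by move=> a f g; apply: fdual_tensor_ext => x y; rewrite linearP /= !bE.
pose bL : {linear Ao -> Ao ⨂ Ao} :=
  HB.pack b (GRing.isLinear.Build K Ao (Ao ⨂ Ao) _ b blin).
by exists bL => f x y; exact: bE.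
Qed.

Section DualStructure.
Variables (one : A) (Delta : {linear A -> A ⨂ A}) (eps : {linear A -> K^o}).
Variable alpha : {linear A -> A}.

Lemma dual_bialgebra_exists : hom_bialgebra mu one Delta eps alpha ->
  exists (muD : {linear Ao ⨂ Ao -> Ao}) (oneD : Ao)
         (DeltaD : {linear Ao -> Ao ⨂ Ao}) (epsD : {linear Ao -> K^o})
         (alphaD : {linear Ao -> Ao}),
    is_dual_bialgebra one Delta eps alpha muD oneD DeltaD epsD alphaD.
Proof.
move=> bA.
have [muD muDE] : exists muD : {linear Ao ⨂ Ao -> Ao},
    forall f g x, muD (f ⊗ g) x = pairing (Delta x) (f ⊗ g).
  apply: dual_op_exists => f g.
  have [|I [Iid Icof I0]] := @dual_op_vanish Delta \0 f g (bialg_DeltaM bA).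
    by move=> x y; rewrite linear0l linear0r addr0 !linear0.
  by exists I; split=> // x /I0[].
have [oneD oneDE] : exists oneD : Ao, oneD =1 eps.
  (* The counit vanishes on its own kernel, an ideal by multiplicativity and of codimension at most
     one. *)
  apply: (@fdualP eps (fun x => eps x = 0)) => //.
    split.
    - by split=> [|a x y ex ey]; rewrite ?linear0 ?linearP ?ex ?ey ?scaler0 ?addr0.
    - by move=> a x ex; rewrite (bialg_epsM bA) ex mulr0.
    - by move=> a x ex; rewrite (bialg_epsM bA) ex mul0r.
  have elin : linear (fun x => (eps x)%:M : 'rV[K]_1).
    by move=> a x y; rewrite linearP /= scale_scalar_mx raddfD.
  pose eL : {linear A -> 'rV[K]_1} := HB.pack (fun x => (eps x)%:M : 'rV[K]_1)
    (GRing.isLinear.Build K A _ _ (fun x => (eps x)%:M : 'rV[K]_1) elin).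
  apply: (@cofinite_ker _ _ _ eL) => x /= /matrixP/(_ 0 0).
  by rewrite !mxE mulr1n.
have [DeltaD DeltaDE] := dual_coproduct_exists.
have [alphaD alphaDE] := dual_map_exists (mu_multiplicative (bialg_assoc bA)).
by exists muD, oneD, DeltaD, (fdual_ev one), alphaD; split.
Qed.

Lemma dual_bracket_exists (delta : {linear A -> A ⨂ A}) :
  hom_bialgebra mu one Delta eps alpha -> coPoisson_compat mu Delta delta ->
  exists brD : {linear Ao ⨂ Ao -> Ao}, is_dual_bracket delta brD.
Proof.
move=> bA deltaM; apply: dual_op_exists => f g.
have [I [Iid Icof I0]] := dual_op_vanish f g (bialg_DeltaM bA) deltaM.
by exists I; split=> // x /I0[].
Qed.

(** * Transposing the bialgebra and Hopf axioms *)

Variables (muD : {linear Ao ⨂ Ao -> Ao}) (oneD : Ao).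
Variables (DeltaD : {linear Ao -> Ao ⨂ Ao}) (epsD : {linear Ao -> K^o}).
Variable alphaD : {linear Ao -> Ao}.
Hypothesis dA : is_dual_bialgebra one Delta eps alpha muD oneD DeltaD epsD alphaD.

Let alphaDE : is_dual_map alpha alphaD := dual_alpha dA.

Lemma dual_op_pairing (d : {linear A -> A ⨂ A}) (dD : {linear Ao ⨂ Ao -> Ao}) :
  (forall f g x, dD (f ⊗ g) x = pairing (d x) (f ⊗ g)) ->
  forall F x, dD F x = pairing (d x) F.
Proof.
move=> dDE F x.
by apply: (tensor_linear_ext (f := fdual_ev x \o dD)) F => f g; exact: dDE.
Qed.

Lemma dual_op_tform (d : {linear A -> A ⨂ A}) (dD : {linear Ao ⨂ Ao -> Ao}) :
  (forall f g x, dD (f ⊗ g) x = pairing (d x) (f ⊗ g)) ->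
  forall f g x, dD (f ⊗ g) x = tform f g (d x).
Proof. by move=> dDE f g x; rewrite dDE pairing_tform. Qed.

Let muDF := dual_op_pairing (dual_mul dA).
Let muDE := dual_op_tform (dual_mul dA).

Lemma pairing_dual_coproduct t f : pairing t (DeltaD f) = f (mu t).
Proof.
elim/tensor_ind: t => [x y||s t hs ht]; first exact: (dual_Delta dA).
  by rewrite pairing0l !linear0.
by rewrite pairingDl !linearD hs ht.
Qed.

(** Both sides equal f(ac) g(bd) when [s] is a ⊗ b and [t] is c ⊗ d; the rest is linearity in [s]
    and [t]. *)
Lemma pairing_dual_coproductM s t f g :
  tform (pairing s) (pairing t) (tau23_4 Ao (DeltaD f ⊗ DeltaD g))
  = tform f g (tmap mu mu (tau23_4 A (s ⊗ t))).
Proof.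
have pair0 : (pairing (0 : A ⨂ A) : {linear Ao ⨂ Ao -> K^o}) =1 \0.
  by move=> F; exact: pairing0l.
have pairD (a b : A ⨂ A) :
    (pairing (a + b) : {linear Ao ⨂ Ao -> K^o}) =1 pairing a \+ pairing b.
  by move=> F; exact: pairingDl.
have tform0l (phi : {linear Ao ⨂ Ao -> K^o}) : tform \0 phi =1 \0.
  by apply: tensor_linear_ext => u v; rewrite tformE mul0r.
have tform0r (phi : {linear Ao ⨂ Ao -> K^o}) : tform phi \0 =1 \0.
  by apply: tensor_linear_ext => u v; rewrite tformE mulr0.
have tformDl (phi psi chi : {linear Ao ⨂ Ao -> K^o}) :
    tform (phi \+ psi) chi =1 tform phi chi \+ tform psi chi.
  by apply: tensor_linear_ext => u v; rewrite /= !tformE mulrDl.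
have tformDr (phi psi chi : {linear Ao ⨂ Ao -> K^o}) :
    tform phi (psi \+ chi) =1 tform phi psi \+ tform phi chi.
  by apply: tensor_linear_ext => u v; rewrite /= !tformE mulrDr.
elim/tensor_ind: s => [a b||s1 s2 h1 h2].
- elim/tensor_ind: t => [c d||t1 t2 h1 h2].
  + by rewrite pairing_tau23_4 !pairing_dual_coproduct tau23_4E tmapE tformE.
  + by rewrite (eq_tform (frefl _) pair0) tform0r linear0r !linear0.
  + by rewrite (eq_tform (frefl _) (pairD _ _)) tformDr /= h1 h2 linearDr !linearD.
- by rewrite (eq_tform pair0 (frefl _)) tform0l linear0l !linear0.
- by rewrite (eq_tform (pairD _ _) (frefl _)) tformDl /= h1 h2 linearDl !linearD.
Qed.

(** Stated for two arbitrary operations, so that products and brackets can be nested in any order: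
    associativity and both sides of the Leibniz rule are instances. *)
Lemma dual_op_hom_assoc_l (d1 d2 : {linear A -> A ⨂ A})
  (b1 b2 : {linear Ao ⨂ Ao -> Ao}) f g h x :
  (forall f g x, b1 (f ⊗ g) x = pairing (d1 x) (f ⊗ g)) ->
  (forall f g x, b2 (f ⊗ g) x = pairing (d2 x) (f ⊗ g)) ->
  b2 (b1 (f ⊗ g) ⊗ alphaD h) x = tform (tform f g) h (tmap d1 alpha (d2 x)).
Proof.
move=> /dual_op_tform b1E /dual_op_tform b2E; rewrite b2E tform_tmap.
by apply: eq_tform => y /=; rewrite ?b1E ?alphaDE.
Qed.

Lemma dual_op_hom_assoc_r (d1 d2 : {linear A -> A ⨂ A})
  (b1 b2 : {linear Ao ⨂ Ao -> Ao}) f g h x :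
  (forall f g x, b1 (f ⊗ g) x = pairing (d1 x) (f ⊗ g)) ->
  (forall f g x, b2 (f ⊗ g) x = pairing (d2 x) (f ⊗ g)) ->
  b2 (alphaD f ⊗ b1 (g ⊗ h)) x
  = tform (tform f g) h (tassocV A A A (tmap alpha d1 (d2 x))).
Proof.
move=> /dual_op_tform b1E /dual_op_tform b2E.
rewrite b2E tform_tassocV tform_tmap.
by apply: eq_tform => y /=; rewrite ?b1E ?alphaDE.
Qed.

Lemma dual_op_multiplicative (d : {linear A -> A ⨂ A})
  (b : {linear Ao ⨂ Ao -> Ao}) f g :
  (forall f g x, b (f ⊗ g) x = pairing (d x) (f ⊗ g)) ->
  (forall x, tmap alpha alpha (d x) = d (alpha x)) ->
  alphaD (b (f ⊗ g)) = b (alphaD f ⊗ alphaD g).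
Proof.
move=> /dual_op_tform bE dM; apply: fdual_ext => x.
rewrite alphaDE !bE -dM tform_tmap.
by apply: eq_tform => y /=; rewrite alphaDE.
Qed.

Lemma dual_hom_bialgebra : hom_bialgebra mu one Delta eps alpha ->
  hom_bialgebra muD oneD DeltaD epsD alphaD.
Proof.
move=> bA.
(* The counit axiom at 1, with Delta(1) = 1 ⊗ 1; it transposes to the invariance of the dual counit
   under [alphaD]. *)
have alpha1 : alpha one = one.
  have [<- _] := bialg_counital bA one.
  by rewrite (bialg_Delta1 bA) tmapE tunit_rE (bialg_eps1 bA) scale1r.
split.
- split=> [f g|f g h].
    exact: (dual_op_multiplicative f g (dual_mul dA)
      (Delta_multiplicative (bialg_coassoc bA))).
  apply: fdual_ext => x.
  rewrite (dual_op_hom_assoc_l _ _ _ _ (dual_mul dA) (dual_mul dA)).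
  rewrite (dual_op_hom_assoc_r _ _ _ _ (dual_mul dA) (dual_mul dA)).
  by rewrite (Delta_coassoc (bialg_coassoc bA)).
- move=> f; split; apply: fdual_ext => x; rewrite alphaDE muDE.
    have [_ <-] := bialg_counital bA x; set t := Delta x.
    apply: (tensor_linear_ext (g := f \o tunit_l A \o tmap eps idfun)) t => y z /=.
    by rewrite tformE tmapE tunit_lE linearZ /= (dual_one dA).
  have [<- _] := bialg_counital bA x; set t := Delta x.
  apply: (tensor_linear_ext (g := f \o tunit_r A \o tmap idfun eps)) t => y z /=.
  by rewrite tformE tmapE tunit_rE linearZ /= (dual_one dA) mulrC.
- split=> f.
    apply: fdual_tensor_ext => x y; rewrite (pairing_tmap _ _ alphaDE alphaDE).
    rewrite tmapE !(dual_Delta dA) alphaDE.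
    by rewrite (mu_multiplicative (bialg_assoc bA)).
  (* Evaluation at x ⊗ y after [DeltaD] is evaluation at xy, so coassociativity tested at x, y, z
     becomes Hom-associativity of A. *)
  have evD x y : tform (fdual_ev x) (fdual_ev y) \o DeltaD =1 fdual_ev (mu (x ⊗ y)).
    by move=> h /=; rewrite -pairing_ev (dual_Delta dA).
  have evA x : fdual_ev x \o alphaD =1 fdual_ev (alpha x).
    by move=> h /=; rewrite /fdual_ev alphaDE.
  apply: fdual_tensor3_ext => x y z; rewrite tform_tassocV !tform_tmap.
  rewrite (eq_tform (evA _) (evD _ _)) (eq_tform (evD _ _) (evA _)).
  by rewrite -!pairing_ev !(dual_Delta dA) (mu_assoc (bialg_assoc bA)).
- have evone : epsD =1 fdual_ev one by exact: (dual_eps dA).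
  move=> f; split; apply: fdual_ext => x; rewrite alphaDE.
    have [_ <-] := bialg_unital bA x; rewrite -(dual_Delta dA) pairing_ev.
    move: (DeltaD f) => F.
    apply: (tensor_linear_ext
      (f := fdual_ev x \o tunit_r Ao \o tmap idfun epsD)) F => g h /=.
    by rewrite tmapE tunit_rE tformE linearZ /= evone mulrC.
  have [<- _] := bialg_unital bA x; rewrite -(dual_Delta dA) pairing_ev.
  move: (DeltaD f) => F.
  apply: (tensor_linear_ext
    (f := fdual_ev x \o tunit_l Ao \o tmap epsD idfun)) F => g h /=.
  by rewrite tmapE tunit_lE tformE linearZ /= evone.
- apply: fdual_tensor_ext => x y.
  by rewrite (dual_Delta dA) pairingE !(dual_one dA) (bialg_epsM bA).
- move=> f g; apply: fdual_tensor_ext => x y.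
  rewrite (dual_Delta dA) muDE (bialg_DeltaM bA) -pairing_dual_coproductM.
  by rewrite pairing_ev tform_tmap; apply: eq_tform => F /=; rewrite -muDF.
- by rewrite (dual_eps dA) (dual_one dA) (bialg_eps1 bA).
- by move=> f g; rewrite !(dual_eps dA) muDE (bialg_Delta1 bA) tformE.
- by move=> f; rewrite !(dual_eps dA) alphaDE alpha1.
Qed.

(** Convolution is self-dual: the convolution of [SD] with the identity sends f to f composed with
    the convolution of [S] with the identity, that is, to f(1) eps. *)
Lemma dual_hom_antipode (S : {linear A -> A}) (SD : {linear Ao -> Ao}) :
  hom_antipode mu one Delta eps S -> is_dual_map S SD ->
  hom_antipode muD oneD DeltaD epsD SD.
Proof.
move=> SA SDE f.
have idDE : is_dual_map (idfun : {linear A -> A}) (idfun : {linear Ao -> Ao}) by [].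
split; apply: fdual_ext => x; rewrite /convolution /= muDF.
  rewrite (pairing_tmap _ _ SDE idDE) pairing_dual_coproduct.
  have [+ _] := SA x; rewrite /convolution /= => ->.
  rewrite linearZ /= (dual_eps dA).
  by rewrite -[RHS]/((f one : K) * oneD x) (dual_one dA) mulrC.
rewrite (pairing_tmap _ _ idDE SDE) pairing_dual_coproduct.
have [_] := SA x; rewrite /convolution /= => ->.
rewrite linearZ /= (dual_eps dA).
by rewrite -[RHS]/((f one : K) * oneD x) (dual_one dA) mulrC.
Qed.

(** * Transposing the Poisson axioms *)

Variables (delta : {linear A -> A ⨂ A}) (brD : {linear Ao ⨂ Ao -> Ao}).
Hypothesis brA : is_dual_bracket delta brD.

Let brDF := dual_op_pairing brA.
Let brDE := dual_op_tform brA.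

Lemma dual_hom_Poisson : hom_bialgebra mu one Delta eps alpha ->
  hom_coPoisson Delta eps alpha delta -> hom_Poisson muD brD alphaD.
Proof.
move=> bA cA; split.
- exact: (bialg_assoc (dual_hom_bialgebra bA)).
- move=> f g; apply: fdual_ext => x.
  by rewrite !muDE -{1}(coP_cocomm cA) tform_tswap.
- split.
  + move=> f g; exact: (dual_op_multiplicative f g brA (coP_multiplicative cA)).
  + move=> f g; apply: fdual_ext => x.
    rewrite -[RHS]/(- (brD (g ⊗ f) x)) !brDE -linearN.
    by rewrite -(coP_skew cA) tform_tswap.
  + move=> f g h; apply: fdual_ext => x.
    (* On forms, [sigma] permutes f, g, h cyclically, so the co-Jacobi sum becomes the three terms
       of the Jacobi identity. *)
    have := coP_jacobi cA x => /= /(congr1 (tform (tform f g) h)).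
    rewrite !linearD !tform_sigma linear0 => jac.
    rewrite -[RHS]jac.
    rewrite -(dual_op_hom_assoc_r f g h x brA brA).
    rewrite -(dual_op_hom_assoc_r g h f x brA brA).
    by rewrite -(dual_op_hom_assoc_r h f g x brA brA).
- move=> f g h; apply: fdual_ext => x.
  rewrite (dual_op_hom_assoc_l f g h x (dual_mul dA) brA) (coP_leibniz cA).
  (* [tau23] exchanges g and h, which turns the second co-Leibniz term into {f, h} alpha°(g). *)
  rewrite linearD tform_tau23.
  rewrite -(dual_op_hom_assoc_r f g h x brA (dual_mul dA)).
  by rewrite -(dual_op_hom_assoc_l f h g x brA (dual_mul dA)).
Qed.

Lemma dual_Poisson_compat :
  coPoisson_compat mu Delta delta -> Poisson_compat muD DeltaD brD.
Proof.
move=> deltaM f g; apply: fdual_tensor_ext => x y.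
rewrite (dual_Delta dA) brDE deltaM !linearD -!pairing_dual_coproductM.
rewrite !pairing_linE !pairing_ev !tform_tmap.
by congr (_ + _); apply: eq_tform => F /=; rewrite -?muDF -?brDF.
Qed.

End DualStructure.

End FiniteDualTheory.

Theorem theorem3p8 (K : fieldType) (K0 : [pchar K] =i pred0) (A : lmodType K)
  (mu : {linear A ⨂ A -> A}) (one : A)
  (Delta : {linear A -> A ⨂ A}) (eps : {linear A -> K^o})
  (alpha : {linear A -> A}) (delta : {linear A -> A ⨂ A})
  (A_anorm : almost_normalizing mu one) :
  (hom_coPoisson_bialgebra mu one Delta eps alpha delta ->
     exists (muD : {linear fdual mu ⨂ fdual mu -> fdual mu}) (oneD : fdual mu)
            (DeltaD : {linear fdual mu -> fdual mu ⨂ fdual mu})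
            (epsD : {linear fdual mu -> K^o})
            (alphaD : {linear fdual mu -> fdual mu})
            (brD : {linear fdual mu ⨂ fdual mu -> fdual mu}),
       [/\ is_dual_bialgebra one Delta eps alpha muD oneD DeltaD epsD alphaD,
           is_dual_bracket delta brD
         & hom_Poisson_bialgebra muD oneD DeltaD epsD alphaD brD])
  /\
  (forall (S : {linear A -> A}) (SD : {linear fdual mu -> fdual mu}),
     hom_coPoisson_Hopf mu one Delta eps alpha delta S ->
     is_dual_map S SD ->
     exists (muD : {linear fdual mu ⨂ fdual mu -> fdual mu}) (oneD : fdual mu)
            (DeltaD : {linear fdual mu -> fdual mu ⨂ fdual mu})
            (epsD : {linear fdual mu -> K^o})
            (alphaD : {linear fdual mu -> fdual mu})
            (brD : {linear fdual mu ⨂ fdual mu -> fdual mu}),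
       [/\ is_dual_bialgebra one Delta eps alpha muD oneD DeltaD epsD alphaD,
           is_dual_bracket delta brD
         & hom_Poisson_Hopf muD oneD DeltaD epsD alphaD brD SD]).
Proof.
split=> [[cA bA deltaM]|S SD [cA [bA SA] deltaM] SDE].
  have [muD [oneD [DeltaD [epsD [alphaD dA]]]]] := dual_bialgebra_exists bA.
  have [brD brA] := dual_bracket_exists bA deltaM.
  exists muD, oneD, DeltaD, epsD, alphaD, brD; split=> //; split.
  - exact: (dual_hom_Poisson dA brA bA cA).
  - exact: (dual_hom_bialgebra dA bA).
  - exact: (dual_Poisson_compat dA brA deltaM).
have [muD [oneD [DeltaD [epsD [alphaD dA]]]]] := dual_bialgebra_exists bA.
have [brD brA] := dual_bracket_exists bA deltaM.
exists muD, oneD, DeltaD, epsD, alphaD, brD; split=> //; split.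
- exact: (dual_hom_Poisson dA brA bA cA).
- split; first exact: (dual_hom_bialgebra dA bA).
  exact: (dual_hom_antipode dA SA SDE).
- exact: (dual_Poisson_compat dA brA deltaM).
Qed.
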